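(* Let $W$ be the affine Coxeter group of type $\widetilde A_2$, i.e. $W=\langle s_1,s_2,s_3\mid s_i^2=1,\ (s_is_j)^3=1\ (i\ne j)\rangle$. Then the Cayley graph of $W$ with respect to $S=\{s_1,s_2,s_3\}$ satisfies the strong hull property: for all $u,v,w\in W$, $|\mathrm{Conv}(u,v)|\cdot|\mathrm{Conv}(v,w)|\ge|\mathrm{Conv}(u,v,w)|$.
   Context: The Cayley graph has vertex set $W$, with $u,v$ adjacent iff $u^{-1}v\in S$; $d$ is the shortest-path distance. A vertex set $C$ is convex if $u,v\in C$ and $d(u,w)+d(w,v)=d(u,v)$ imply $w\in C$. $\mathrm{Conv}(X)$ is the smallest convex set containing $X$, and $\mathrm{Conv}(u,v)=\mathrm{Conv}(\{u,v\})$, etc. *)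

(* Defs.v *)
From HB Require Import structures.
From mathcomp Require Import all_boot.
From mathcomp Require Import finmap.
From mathcomp Require Import boolp classical_sets functions cardinality.

Set Implicit Arguments.
Unset Strict Implicit.
Unset Printing Implicit Defensive.

Local Open Scope classical_set_scope.

Section Graph.
Variables (T : choiceType) (e : rel T).

Definition walk (n : nat) (u v : T) : Prop :=
  exists p : seq T, [/\ path e u p, last u p = v & size p = n].

(* [gdist u v] is 0 when no walk joins u to v; this does not happen in the
   Cayley graph of a group with respect to a generating set closed under
   inversion. *)
Definition gdist (u v : T) : nat :=
  match pselect (exists n, `[< walk n u v >]) with
  | left ex => ex_minn ex
  | right _ => 0
  end.

Definition gconvex (C : set T) : Prop :=
  forall u v w, C u -> C v -> gdist u w + gdist w v = gdist u v -> C w.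

Definition Conv (X : set T) : set T := smallest gconvex X.

(* [fset_set A] is the empty set when A is infinite, hence the finiteness
   conjunct; it also yields the finiteness of the two other hulls, which are
   contained in [Conv [set u; v; w]]. *)
Definition strong_hull_property : Prop :=
  forall u v w : T,
    finite_set (Conv [set u; v; w]) /\
    #|` fset_set (Conv [set u; v]) | * #|` fset_set (Conv [set v; w]) |
      >= #|` fset_set (Conv [set u; v; w]) |.

End Graph.

Definition cayley (G : groupType) (S : set G) : rel G :=
  fun u v => (u^-1 * v)%g \in S.

Definition A2tilde_relations (G : groupType) (s : 'I_3 -> G) : Prop :=
  (forall i, (s i ^+ 2)%g = 1%g) /\
  (forall i j, i != j -> ((s i * s j) ^+ 3)%g = 1%g).

(* The group presented by the relations, up to isomorphism: the universal
   property of a presentation. *)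
Definition A2tilde_group (W : groupType) (s : 'I_3 -> W) : Prop :=
  A2tilde_relations s /\
  forall (G : groupType) (t : 'I_3 -> G), A2tilde_relations t ->
    exists! f : W -> G,
      {morph f : x y / (x * y)%g} /\ (forall i, f (s i) = t i).

(* Existence of the presented group, as a quotient of the words in the
   generators; the inverse of a word is its reversal as the generators are
   involutions. *)
Section Existence.

Let ev (G : groupType) (t : 'I_3 -> G) (w : seq 'I_3) : G :=
  (\prod_(i <- w) t i)%g.

Let ev_cat (G : groupType) (t : 'I_3 -> G) w1 w2 :
  ev t (w1 ++ w2) = (ev t w1 * ev t w2)%g.
Proof. exact: big_cat. Qed.

Let ev_rev (G : groupType) (t : 'I_3 -> G) w :
  A2tilde_relations t -> ev t (rev w) = (ev t w)^-1%g.
Proof.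
move=> [t2 _]; elim: w => [|i w IHw]; first by rewrite /ev !big_nil invg1.
have tV : (t i)^-1%g = t i.
  by apply: (mulgI (t i)); rewrite mulgV -(t2 i) expgS expg1.
rewrite rev_cons -cats1 ev_cat IHw.
rewrite -[i :: w]cat1s ev_cat invgM; congr (_ * _)%g.
by rewrite /ev big_seq1 tV.
Qed.

Let weq (w1 w2 : seq 'I_3) : bool :=
  `[< forall (G : groupType) (t : 'I_3 -> G),
        A2tilde_relations t -> ev t w1 = ev t w2 >].

Let weq_refl : reflexive weq.
Proof. by move=> w; apply/asboolP. Qed.

Let weq_sym : symmetric weq.
Proof.
by move=> w1 w2; apply/asboolP/asboolP => h G t ht; rewrite (h _ _ ht).
Qed.

Let weq_trans : transitive weq.
Proof.
move=> w1 w2 w3 /asboolP h1 /asboolP h2.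
by apply/asboolP => G t ht; rewrite (h1 _ _ ht); apply: h2.
Qed.

Let weqR := EquivRel weq weq_refl weq_sym weq_trans.
Let W : choiceType := {eq_quot weqR}%qT.
Let cl (w : seq 'I_3) : W := (\pi_({eq_quot weqR}) w)%qT.
Let rp (x : W) : seq 'I_3 := generic_quotient.repr x.

Let clP w1 w2 :
  (forall (G : groupType) (t : 'I_3 -> G),
     A2tilde_relations t -> ev t w1 = ev t w2) -> cl w1 = cl w2.
Proof. by move=> h; apply/eqquotP; apply/asboolP. Qed.

Let rpK x : cl (rp x) = x.
Proof. exact: reprK. Qed.

Let clK w (G : groupType) (t : 'I_3 -> G) :
  A2tilde_relations t -> ev t (rp (cl w)) = ev t w.
Proof.
have : cl (rp (cl w)) = cl w by exact: rpK.
by move=> /eqquotP /asboolP h ht; apply: h.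
Qed.

Let one := cl [::].
Let mul (x y : W) := cl (rp x ++ rp y).
Let inv (x : W) := cl (rev (rp x)).

Let mulA : associative mul.
Proof.
by move=> x y z; apply: clP => G t ht; rewrite !(ev_cat, clK) // mulgA.
Qed.

Let mul1 : left_id one mul.
Proof.
move=> x; rewrite -[RHS]rpK; apply: clP => G t ht.
by rewrite ev_cat clK // /ev big_nil mul1g.
Qed.

Let mulr1 : right_id one mul.
Proof.
move=> x; rewrite -[RHS]rpK; apply: clP => G t ht.
by rewrite ev_cat clK // /ev big_nil mulg1.
Qed.

Let mulV : left_inverse one inv mul.
Proof.
move=> x; apply: clP => G t ht.
by rewrite ev_cat clK // ev_rev // mulVg /ev big_nil.
Qed.

Let mulrV : right_inverse one inv mul.
Proof.
move=> x; apply: clP => G t ht.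
by rewrite ev_cat clK // ev_rev // mulgV /ev big_nil.
Qed.

Let Wgroup : groupType :=
  HB.pack_for groupType (Choice.sort W) (Choice.class W)
    (isGroup.Build W mulA mul1 mulr1 mulV mulrV).

Let gen (i : 'I_3) : Wgroup := cl [:: i].

Let mul_cl w1 w2 : ((cl w1 : Wgroup) * (cl w2 : Wgroup))%g = cl (w1 ++ w2).
Proof. by apply: clP => G t ht; rewrite !(ev_cat, clK). Qed.

Lemma A2tilde_group_exists :
  exists (W0 : groupType) (s : 'I_3 -> W0), A2tilde_group s.
Proof.
have ev1 (G : groupType) (t : 'I_3 -> G) i : ev t [:: i] = t i.
  exact: big_seq1.
exists Wgroup, gen; split.
  split=> [i | i j nij].
    rewrite expgS expg1; apply: clP => G t ht.
    by rewrite ev_cat !clK // ev1 /ev big_nil -(ht.1 i) expgS expg1.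
  rewrite !expgS expg0 mulg1; apply: clP => G t ht.
  rewrite !(ev_cat, clK) // !ev1 /ev big_nil -(ht.2 i j nij).
  by rewrite !expgS expg0 mulg1.
move=> G t ht; exists (fun x : Wgroup => ev t (rp x)); split.
  split=> [x y | i]; first by rewrite clK // ev_cat.
  by rewrite clK // /ev big_seq1.
move=> f [fM fs]; apply: funext => x.
have f1 : f 1%g = 1%g.
  by apply: (mulgI (f 1%g)); rewrite -fM !mulg1.
have fcl w : f (cl w) = ev t w.
  elim: w => [|i w IHw]; first by rewrite f1 /ev big_nil.
  by rewrite -cat1s -mul_cl fM IHw ev_cat [f _]fs /ev big_seq1.
by rewrite -fcl; congr f; rewrite rpK.
Qed.

End Existence.

(* Main.v *)
(* W acts on Z^3 by the affine maps s_1 : (a,b,c) |-> (1-a,-c,-b) and its two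
   analogues, which preserve the l1-metric. The orbit map at the origin
   identifies the Cayley graph with the points of coordinate sum 0 or 1 (the
   hexagonal lattice, adjacency being l1-distance 1): each nonzero such point
   is brought closer to 0 by some s_i, and two different descents are reconciled
   by a braid relation. The graph distance is then the l1-distance, so an
   interval is the set of lattice points in a box. If two points differ by
   +-(m, n, -D) up to order, with m, n, D >= 0, their interval has
   2mn + m + n + D + 1 points, while a box with sides a, b, c contains at most
   (a + 1)(b + c + 1) lattice points, since x_2 - x_3 is injective on each slice
   x_1 = constant. Choosing for x_1 the direction of the shortest side of the
   box spanned by u, v, w, the theorem becomes an inequality between
   polynomials. *)
Require Import Defs.
From Stdlib Require Import ZArith Lia.
From HB Require Import structures.
From mathcomp Require Import all_boot.
From mathcomp Require Import finmap.
From mathcomp Require Import boolp classical_sets functions cardinality.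

Set Implicit Arguments.
Unset Strict Implicit.
Unset Printing Implicit Defensive.

#[local] Arguments Z.add : simpl never.
#[local] Arguments Z.sub : simpl never.
#[local] Arguments Z.opp : simpl never.
#[local] Arguments Z.mul : simpl never.

(** * Permutation actions of the presented group *)

(** Permutations of [T] form a group, so the universal property of [W] turns compatible involutions
    of [T] into an action of [W]. *)
Record bij (T : Type) := Bij {
  bfun :> T -> T;
  binv : T -> T;
  bfunK : cancel bfun binv;
  binvK : cancel binv bfun }.

Section BijGroup.
Variable T : Type.
Implicit Types f g h : bij T.

Lemma bijP f g : bfun f =1 bfun g -> f = g.
Proof.
move=> /funext; case: f g => [f f' fK f'K] [g g' gK g'K] /= fg.
rewrite -{}fg in gK g'K *.
have f'g' : f' = g' by apply: funext => x; rewrite -[in LHS](g'K x) fK.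
rewrite -{}f'g' in gK g'K *.
by congr Bij; apply: Prop_irrelevance.
Qed.

HB.instance Definition _ := gen_eqMixin (bij T).
HB.instance Definition _ := gen_choiceMixin (bij T).

Definition bij1 : bij T := @Bij T id id (fun=> erefl) (fun=> erefl).
Definition bij_mul f g : bij T :=
  Bij (can_comp (bfunK f) (bfunK g)) (can_comp (binvK g) (binvK f)).
Definition bij_inv f : bij T := Bij (binvK f) (bfunK f).

Lemma bij_mulA : associative bij_mul.
Proof. by move=> f g h; apply: bijP. Qed.
Lemma bij_mul1 : left_id bij1 bij_mul.
Proof. by move=> f; apply: bijP. Qed.
Lemma bij_mulr1 : right_id bij1 bij_mul.
Proof. by move=> f; apply: bijP. Qed.
Lemma bij_mulV : left_inverse bij1 bij_inv bij_mul.
Proof. by move=> f; apply: bijP => x /=; rewrite bfunK. Qed.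
Lemma bij_mulrV : right_inverse bij1 bij_inv bij_mul.
Proof. by move=> f; apply: bijP => x /=; rewrite binvK. Qed.

HB.instance Definition _ :=
  isGroup.Build (bij T) bij_mulA bij_mul1 bij_mulr1 bij_mulV bij_mulrV.

Definition bij_invol (s : T -> T) (sK : involutive s) : bij T := Bij sK sK.

End BijGroup.

Section Presentation.
Variables (W : groupType) (s : 'I_3 -> W).
Hypothesis hW : A2tilde_group s.
Local Open Scope group_scope.

Lemma gen_mulK i : involutive (fun x => s i * x).
Proof. by move=> x; rewrite mulgA -expg2 hW.1.1 mul1g. Qed.

Lemma A2tilde_action (T : Type) (t : 'I_3 -> T -> T) :
    (forall i, involutive (t i)) ->
    (forall i j x, i != j -> t i (t j (t i (t j (t i (t j x))))) = x) ->
  exists r : W -> T -> T,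
   [/\ forall x, r 1 x = x, forall u v x, r (u * v) x = r u (r v x) &
       forall i x, r (s i) x = t i x].
Proof.
move=> tK tB.
pose b i : bij T := bij_invol (tK i).
have [] := hW.2 _ b.
  split=> [i | i j nij]; first by apply: bijP => x; rewrite expg2; apply: tK.
  by apply: bijP => x; rewrite !expgS expg0 mulg1; apply: tB.
move=> f [[fM fs] _]; exists (fun u x => f u x); split.
- have -> : f 1 = 1 by apply: (mulgI (f 1)); rewrite -fM !mulg1.
  by [].
- by move=> u v x; rewrite fM.
- by move=> i x; rewrite fs.
Qed.

(** That the generators generate [W] comes from the uniqueness half of the universal property: two
    morphisms that agree on the generators coincide. *)
Lemma A2tilde_ind (P : W -> Prop) :
  P 1 -> (forall i x, P x -> P (s i * x)) -> forall x, P x.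
Proof.
move=> P1 Ps.
have PsE i x : `[< P (s i * x) >] = `[< P x >].
  apply/asboolP/asboolP => [h|]; last exact: Ps.
  by rewrite -[x](gen_mulK i); apply: Ps.
pose T := (W * bool)%type.
(* Both [lam] and its conjugate by the involution [z |-> (z.1, z.2 (+) P z.1)]
   are actions extending the same generators. *)
have lK (x : W) : cancel (fun z : T => (x * z.1, z.2)) (fun z => (x^-1 * z.1, z.2)).
  by move=> [y b] /=; rewrite mulKg.
have lVK (x : W) : cancel (fun z : T => (x^-1 * z.1, z.2)) (fun z => (x * z.1, z.2)).
  by move=> [y b] /=; rewrite mulVKg.
pose lam x : bij T := Bij (lK x) (lVK x).
have thK : involutive (fun z : T => (z.1, z.2 (+) `[< P z.1 >])).
  by move=> [y b] /=; rewrite addbK.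
pose th : bij T := bij_invol thK.
pose lam' x : bij T := th * lam x * th.
have [] := hW.2 _ (fun i => lam (s i)).
  split=> [i | i j nij]; apply: bijP => -[y b]; rewrite !expgS expg0 mulg1 /=.
    by rewrite [s i * _]gen_mulK.
  congr (_, _); rewrite !mulgA -[RHS]mul1g -(hW.1.2 i j nij).
  by rewrite !expgS expg0 mulg1 !mulgA.
move=> f [_ funi].
have lamE : f = lam.
  apply: funi; split=> // x y; apply: bijP => -[z b] /=.
  by rewrite mulgA.
have lam'E : f = lam'.
  apply: funi; split=> [x y | i]; apply: bijP => -[z b] /=.
    by rewrite addbK mulgA.
  by rewrite PsE addbK.
(* At [(1, false)], [lam x] gives the bit [false], while [lam' x] gives the negation of [P x], since
   [P 1] holds. *)
move=> x; have := congr1 (fun g => bfun (g x) (1, false)) (etrans (esym lamE) lam'E).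
by rewrite /= mulg1 asboolT //= => -[] /esym /negbFE /asboolP.
Qed.

End Presentation.

(** * Hexagonal coordinates *)

(* The hexagonal lattice embedded in Z^3: A, B and C number the strips between
   the walls of the three parallel classes. *)
Definition hexcoord (T : Type) (A B C : T -> Z) : Prop :=
  [/\ forall x, (0 <= A x + B x + C x <= 1)%Z,
      forall a b c, (0 <= a + b + c <= 1)%Z ->
        exists x, [/\ A x = a, B x = b & C x = c] &
      forall x y, A x = A y -> B x = B y -> C x = C y -> x = y].

Definition dist (T : Type) (A B C : T -> Z) (x y : T) : Z :=
  (Z.abs (A x - A y) + Z.abs (B x - B y) + Z.abs (C x - C y))%Z.

(** * The affine reflections of Z^3 and their descents *)

Section Reflections.
Local Open Scope Z_scope.

Definition Z3 : Type := (Z * Z * Z)%type.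
Implicit Types x y : Z3.
Implicit Types i j : 'I_3.

Definition c1 x := x.1.1.
Definition c2 x := x.1.2.
Definition c3 x := x.2.

Definition reflection i x : Z3 :=
  match val i with
  | 0%N => (1 - c1 x, - c3 x, - c2 x)
  | 1%N => (- c3 x, 1 - c2 x, - c1 x)
  | _ => (- c2 x, - c1 x, 1 - c3 x)
  end.

Definition coord i x : Z :=
  match val i with 0%N => c1 x | 1%N => c2 x | _ => c3 x end.

Definition o3 : Z3 := (0, 0, 0).
Definition on_hex x : Prop := 0 <= c1 x + c2 x + c3 x <= 1.
Definition d1 : Z3 -> Z3 -> Z := dist c1 c2 c3.

Lemma Z3P x y : c1 x = c1 y -> c2 x = c2 y -> c3 x = c3 y -> x = y.
Proof. by case: x y => [[? ?] ?] [[? ?] ?]; rewrite /c1 /c2 /c3 /= => -> -> ->. Qed.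

Ltac ord3 i := case: i => [[|[|[|//]]] ?].
Ltac z3 := rewrite /= /d1 /dist /on_hex /reflection /coord /o3 /c1 /c2 /c3 /=; lia.
Ltac z3eq := apply: Z3P; z3.

Lemma reflK i : involutive (reflection i).
Proof. by move=> x; ord3 i; z3eq. Qed.

Lemma refl_braid i j x : i != j ->
  reflection i (reflection j (reflection i x)) =
  reflection j (reflection i (reflection j x)).
Proof. by ord3 i; ord3 j => // _; z3eq. Qed.

Lemma refl_isometry i x y : d1 (reflection i x) (reflection i y) = d1 x y.
Proof. by ord3 i; z3. Qed.

Lemma refl_on_hex i x : on_hex x -> on_hex (reflection i x).
Proof. by ord3 i; z3. Qed.

Lemma coord_refl i x : coord i (reflection i x) = 1 - coord i x.
Proof. by ord3 i; z3. Qed.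

Lemma refl_descent i x :
  1 <= coord i x -> d1 o3 (reflection i x) = d1 o3 x - 1.
Proof.
by ord3 i; rewrite /= /d1 /dist /reflection /coord /o3 /c1 /c2 /c3 /=; lia.
Qed.

(** Two descents at [x] extend to a whole braid word of descents. The first reflection moves minus
    the third coordinate, which is at least x_i + x_j - 1, to place j; the second then moves x_j to
    place i. *)
Lemma coord_refl_pos i j x : i != j -> on_hex x ->
  1 <= coord i x -> 1 <= coord j x ->
  1 <= coord j (reflection i x) /\ 1 <= coord i (reflection j (reflection i x)).
Proof.
by ord3 i; ord3 j => // _; rewrite /on_hex /reflection /coord /c1 /c2 /c3 /=; lia.
Qed.

Lemma d1_o3_eq0 x : d1 o3 x <= 0 -> x = o3.
Proof. by move=> h; move: h; rewrite /d1 /dist /o3 /c1 /c2 /c3 /= => h; z3eq. Qed.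

Lemma d1_ge0 x y : 0 <= d1 x y.
Proof. z3. Qed.

Definition ord3_0 : 'I_3 := @Ordinal 3 0 isT.
Definition ord3_1 : 'I_3 := @Ordinal 3 1 isT.
Definition ord3_2 : 'I_3 := @Ordinal 3 2 isT.

Definition descent x : 'I_3 :=
  if 1 <=? c1 x then ord3_0 else if 1 <=? c2 x then ord3_1 else ord3_2.

(** If all coordinates were at most 0, their nonnegative sum would force them all to vanish; so the
    default third branch of [descent] is correct away from the origin. *)
Lemma descentP x : on_hex x -> x <> o3 -> 1 <= coord (descent x) x.
Proof.
move=> hx x0; rewrite /descent; case: Z.leb_spec => // h1.
case: Z.leb_spec => // h2; rewrite /coord /=.
suff : c3 x <> 0 \/ c2 x <> 0 \/ c1 x <> 0 by move: hx; rewrite /on_hex; lia.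
apply: contrapT => h; apply: x0; apply: Z3P; rewrite /o3 /c1 /c2 /c3 /= in h *; lia.
Qed.

Lemma refl_o3_of_dist1 x : on_hex x -> d1 o3 x = 1 -> exists i, x = reflection i o3.
Proof.
move=> hx dx; have x0 : x <> o3 by move=> x0; rewrite x0 in dx.
exists (descent x); rewrite -[LHS](reflK (descent x)); congr reflection.
by apply: d1_o3_eq0; rewrite (refl_descent (descentP hx x0)) dx.
Qed.

End Reflections.

(** * Identification of the Cayley graph with the hexagonal lattice *)

Section Coordinates.
Variables (W : groupType) (s : 'I_3 -> W).
Hypothesis hW : A2tilde_group s.
Local Open Scope group_scope.

Lemma gen_invol i : s i * s i = 1.
Proof. by rewrite -expg2 hW.1.1. Qed.

Lemma gen_braid i j : i != j -> s i * s j * s i = s j * s i * s j.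
Proof.
move=> nij; have := hW.1.2 i j nij; rewrite !expgS expg0 mulg1 => h.
have genK x k : x * s k * s k = x by rewrite -mulgA gen_invol mulg1.
by rewrite -[RHS]mul1g -h !mulgA !genK.
Qed.

(** Inverse of the orbit map at the origin, read off from greedy descents. The fuel [n] is the
    distance to the origin, which drops by 1 at each descent. *)
Fixpoint lift_rec n (x : Z3) : W :=
  if n is n'.+1 then s (descent x) * lift_rec n' (reflection (descent x) x) else 1.

Definition lift x := lift_rec (Z.to_nat (d1 o3 x)) x.

Lemma lift_descent x : on_hex x -> x <> o3 ->
  lift x = s (descent x) * lift (reflection (descent x) x).
Proof.
move=> hx x0; have := descentP hx x0 => /refl_descent e.
have := @d1_ge0 o3 (reflection (descent x) x).
rewrite /lift => h0; have -> : Z.to_nat (d1 o3 x) =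
    (Z.to_nat (d1 o3 (reflection (descent x) x))).+1.
  by rewrite e; lia.
by [].
Qed.

(** The greedy choice is immaterial. If it is j rather than i, induction on the distance unfolds the
    two sides along the words jij and iji, which agree both in [W] and on the lattice. *)
Lemma lift_refl_pos x i : on_hex x -> (1 <= coord i x)%Z ->
  lift x = s i * lift (reflection i x).
Proof.
have [n] := ubnP (Z.to_nat (d1 o3 x)); elim: n x i => // n IHn x i /ltP hn hx ix.
have x0 : x <> o3.
  move=> x0; move: ix; rewrite x0.
  by case: (i) => [[|[|[|//]]] ?]; rewrite /coord /c1 /c2 /c3 /=; lia.
have jx := descentP hx x0; rewrite lift_descent //.
set j := descent x in jx *.
have [->//|nij] := eqVneq i j.
have nji : j != i by rewrite eq_sym.
have [j1 i2] := coord_refl_pos nij hx ix jx.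
have [i1 j2] := coord_refl_pos nji hx jx ix.
have di := refl_descent ix; have dj := refl_descent jx.
have dij := refl_descent j1; have dji := refl_descent i1.
have g0 := @d1_ge0 o3 (reflection i x); have g1 := @d1_ge0 o3 (reflection j x).
have g2 := @d1_ge0 o3 (reflection j (reflection i x)).
have g3 := @d1_ge0 o3 (reflection i (reflection j x)).
rewrite (IHn (reflection i x) j) ?(IHn (reflection j x) i) //;
  do ?exact: refl_on_hex; do ?by apply/ltP; lia.
rewrite (IHn (reflection i (reflection j x)) j) ?(IHn (reflection j (reflection i x)) i) //;
  do ?[by do 2 apply: refl_on_hex]; do ?by apply/ltP; lia.
by rewrite !mulgA (refl_braid x nij) (gen_braid nij).
Qed.

(** Coordinate i becomes 1 minus itself, so i is a descent either at [x] or at its reflection. *)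
Lemma lift_refl i x : on_hex x -> lift (reflection i x) = s i * lift x.
Proof.
move=> hx; case: (Z_le_gt_dec 1 (coord i x)) => h.
  by rewrite (lift_refl_pos hx h) mulgA gen_invol mul1g.
rewrite (@lift_refl_pos (reflection i x) i) ?reflK //; first exact: refl_on_hex.
rewrite coord_refl; lia.
Qed.

Lemma A2tilde_coords : exists A B C : W -> Z,
  hexcoord A B C /\
  forall u v, cayley (range s) u v <-> dist A B C u v = 1%Z.
Proof.
have refl6 i j x : i != j -> reflection i (reflection j (reflection i
    (reflection j (reflection i (reflection j x))))) = x.
  by move=> nij; rewrite (refl_braid _ nij) !reflK.
have [r [r1 rM rs]] := A2tilde_action hW reflK refl6.
pose P u := r u o3.
have rI u x y : d1 (r u x) (r u y) = d1 x y.
  elim/(A2tilde_ind hW): u => [|i u IHu]; first by rewrite !r1.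
  by rewrite !rM !rs refl_isometry.
have Phex u : on_hex (P u).
  elim/(A2tilde_ind hW): u => [|i u IHu]; first by rewrite /P r1.
  by rewrite /P rM rs; apply: refl_on_hex.
(* Equivariance of [lift] makes it a left inverse of the orbit map. *)
have PK u : lift (P u) = u.
  elim/(A2tilde_ind hW): u => [|i u IHu]; first by rewrite /P r1.
  by rewrite /P rM rs lift_refl ?[lift _]IHu //; apply: Phex.
have Pinj u v : P u = P v -> u = v by move=> e; rewrite -(PK u) e PK.
have Psurj x : on_hex x -> exists u, P u = x.
  have [n] := ubnP (Z.to_nat (d1 o3 x)); elim: n x => // n IHn x /ltP hn hx.
  have [->|x0] := EM (x = o3); first by exists 1; rewrite /P r1.
  have jx := descentP hx x0.
  have [|u Pu] := IHn _ _ (refl_on_hex (descent x) hx).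
    by rewrite (refl_descent jx); apply/ltP; have := @d1_ge0 o3 (reflection (descent x) x);
       rewrite (refl_descent jx); lia.
  by exists (s (descent x) * u); rewrite /P rM rs [r u o3]Pu reflK.
exists (c1 \o P), (c2 \o P), (c3 \o P); split; first split.
- exact: Phex.
- move=> a b c abc; have [u Pu] := Psurj (a, b, c) abc.
  by exists u; rewrite /= Pu.
- by move=> u v e1 e2 e3; apply: Pinj; apply: Z3P.
(* [W] acts by isometries, so adjacency need only be compared at the origin. *)
have dE u v : d1 (P u) (P v) = d1 o3 (P (u^-1 * v)).
  by rewrite -[LHS](rI u^-1) /P -!rM mulVg r1.
move=> u v; change (dist (c1 \o P) (c2 \o P) (c3 \o P) u v) with (d1 (P u) (P v)).
rewrite dE /cayley; split=> [/set_mem [i _ <-] | /(refl_o3_of_dist1 (Phex _)) [i Pi]].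
  by rewrite /P rs; case: i => [[|[|[|//]]] ?].
by apply/mem_set; exists i => //; apply: Pinj; rewrite Pi /P rs.
Qed.

End Coordinates.

(** * Distance and convexity *)

Section HexGraph.
Variables (T : choiceType) (e : rel T) (A B C : T -> Z).
Hypothesis hex : hexcoord A B C.
Hypothesis eE : forall u v, e u v <-> dist A B C u v = 1%Z.
Local Open Scope Z_scope.
Notation d := (dist A B C).

(** From coordinate sum 0 one may only increase a coordinate, from sum 1 only decrease one. As [v]
    also has sum 0 or 1 and differs from [u], some coordinate of [v] lies on the required side. *)
Lemma dist_closer u v : u <> v -> exists2 u', d u u' = 1 & d u' v = d u v - 1.
Proof.
case: hex => bd ex inj nuv.
have step a b c : 0 <= a + b + c <= 1 ->
    Z.abs (A u - a) + Z.abs (B u - b) + Z.abs (C u - c) = 1 ->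
    Z.abs (a - A v) + Z.abs (b - B v) + Z.abs (c - C v) = d u v - 1 ->
  exists2 u', d u u' = 1 & d u' v = d u v - 1.
  by move=> /ex[u' [<- <- <-]]; exists u'.
have hu := bd u; have hv := bd v.
have nC : A u <> A v \/ B u <> B v \/ C u <> C v.
  by apply: contrapT => h; apply: nuv; apply: inj; lia.
have [s0|s1] : A u + B u + C u = 0 \/ A u + B u + C u = 1 by lia.
  have [h|[h|h]] : A u < A v \/ B u < B v \/ C u < C v by lia.
  - by apply: (step (A u + 1) (B u) (C u)); rewrite /dist; lia.
  - by apply: (step (A u) (B u + 1) (C u)); rewrite /dist; lia.
  - by apply: (step (A u) (B u) (C u + 1)); rewrite /dist; lia.
have [h|[h|h]] : A v < A u \/ B v < B u \/ C v < C u by lia.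
- by apply: (step (A u - 1) (B u) (C u)); rewrite /dist; lia.
- by apply: (step (A u) (B u - 1) (C u)); rewrite /dist; lia.
- by apply: (step (A u) (B u) (C u - 1)); rewrite /dist; lia.
Qed.

Lemma dist_le_walk n u v : walk e n u v -> d u v <= Z.of_nat n.
Proof.
case=> p [up <- <-]; elim: p u up => [|x p IHp] u /=.
  by move=> _; rewrite /dist; lia.
case/andP => /eE ux /IHp; move: ux; rewrite /dist; lia.
Qed.

Lemma walk_dist u v : walk e (Z.to_nat (d u v)) u v.
Proof.
have [n] := ubnP (Z.to_nat (d u v)); elim: n u => // n IHn u /ltP hn.
have [->|nuv] := EM (u = v).
  by exists [::]; split=> //=; rewrite /dist; lia.
have [u' uu' u'v] := dist_closer nuv.
have d0 : 0 <= d u' v by rewrite /dist; lia.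
case: (IHn u'); first by apply/ltP; lia.
move=> p [pp pl ps]; exists (u' :: p); split=> //=.
  by rewrite pp andbT; apply/eE.
by rewrite ps u'v; lia.
Qed.

Lemma gdistE u v : Z.of_nat (gdist e u v) = d u v.
Proof.
have d0 : 0 <= d u v by rewrite /dist; lia.
rewrite /gdist; case: pselect => [ex|[]]; last first.
  by exists (Z.to_nat (d u v)); apply/asboolP; apply: walk_dist.
case: ex_minnP => n /asboolP /dist_le_walk h /(_ (Z.to_nat (d u v))) h'.
have /leP := h' (asboolT (@walk_dist u v)); lia.
Qed.

Lemma Conv_between u v x : d u x + d x v = d u v -> Conv e [set u; v]%classic x.
Proof.
move=> h K [Kc Ks]; apply: (Kc u v x); try by apply: Ks; [left|right].
  by apply: Ks; left.
  by apply: Ks; right.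
apply: Nat2Z.inj; rewrite -plusE Nat2Z.inj_add !gdistE //.
Qed.

Definition in_box3 u v w x : Prop :=
  forall F, (F = A \/ F = B \/ F = C) ->
  Z.min (F u) (Z.min (F v) (F w)) <= F x <= Z.max (F u) (Z.max (F v) (F w)).

(** The box is convex and contains the three points: equality in the l1 triangle inequality puts
    each coordinate of the middle point between those of the ends. *)
Lemma Conv_box3 u v w x : Conv e [set u; v; w]%classic x -> in_box3 u v w x.
Proof.
apply; split=> [y1 y2 z h1 h2|z].
  move=> /(congr1 Z.of_nat); rewrite -plusE Nat2Z.inj_add !gdistE /dist => h F hF.
  have hc : F y1 <= F z <= F y2 \/ F y2 <= F z <= F y1.
    by case: hF => [|[|]] ->; lia.
  have := h1 F hF; have := h2 F hF.
  by move: (Z.min _ _) (Z.max _ _) => lo hi; lia.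
by case=> [[->|->]|->] F hF; lia.
Qed.

End HexGraph.

(** * The numerical inequality *)

Section Arithmetic.
Local Open Scope Z_scope.

(* Up to order, the difference of two distinct lattice points is +-(m, n, -D). *)
Definition diff_sizes m n D :=
  [/\ 0 <= m <= D, 0 <= n <= D, 1 <= D & m + n - 1 <= D <= m + n + 1].

Definition signed_sizes p q r m n D :=
  p = m /\ q = n /\ r = - D \/ p = - m /\ q = - n /\ r = D.

Definition perm_sizes p q r m n D :=
  signed_sizes p q r m n D \/ signed_sizes p r q m n D \/
  signed_sizes q r p m n D.

Definition interval_size m n D := 2 * m * n + m + n + D + 1.

(** One side of the box spanned by u, v, w, with v moved to 0 and with [p], [r] the corresponding
    coordinates of u and w. *)
Definition hull_len p r := Z.max 0 (Z.max p r) - Z.min 0 (Z.min p r).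

(* [(a + 1) * (b + c + 1)] bounds the number of lattice points in a box with
   sides [a], [b], [c]. *)
Definition slab_le a b c k :=
  (a + 1) * (b + c + 1) <= k \/ (b + 1) * (a + c + 1) <= k \/
  (c + 1) * (a + b + 1) <= k.

Lemma interval_sizeC m n D : interval_size m n D = interval_size n m D.
Proof. rewrite /interval_size; ring. Qed.

Lemma diff_sizesC m n D : diff_sizes m n D -> diff_sizes n m D.
Proof. by case=> *; split=> //; lia. Qed.

Lemma signed_sizesC p q r m n D :
  signed_sizes p q r m n D -> signed_sizes q p r n m D.
Proof. rewrite /signed_sizes; tauto. Qed.

Lemma slab_leC a b c k : slab_le a b c k -> slab_le b a c k.
Proof. rewrite /slab_le (Z.add_comm b a); tauto. Qed.

Lemma slab_le_rot a b c k : slab_le a b c k -> slab_le b c a k.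
Proof. rewrite /slab_le (Z.add_comm c a) (Z.add_comm b a); tauto. Qed.

(** [D] is the largest absolute value. As the sum is within 1 of 0, a coordinate attaining it can be
    chosen with sign weakly opposite to the other two. *)
Lemma perm_sizes_exist p q r :
    -1 <= p + q + r <= 1 -> p <> 0 \/ q <> 0 \/ r <> 0 ->
  exists m n D, diff_sizes m n D /\ perm_sizes p q r m n D.
Proof.
pose dominates z x y := (x <= 0 /\ y <= 0 /\ 0 <= z \/ 0 <= x /\ 0 <= y /\ z <= 0)
  /\ Z.abs x <= Z.abs z /\ Z.abs y <= Z.abs z.
have dom x y z : dominates z x y -> -1 <= x + y + z <= 1 ->
    x <> 0 \/ y <> 0 \/ z <> 0 ->
  exists m n D, diff_sizes m n D /\ signed_sizes x y z m n D.
  move=> h hs h0; exists (Z.abs x), (Z.abs y), (Z.abs z).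
  by move: h; rewrite /dominates /signed_sizes => h; split; [split|]; lia.
move=> hs h0.
have : dominates r p q \/ dominates q p r \/ dominates p q r.
  by rewrite /dominates; lia.
by case=> [h|[h|h]]; have [||m [n [D [K F]]]] := dom _ _ _ h; try lia;
  exists m, n, D; split=> //; rewrite /perm_sizes; tauto.
Qed.

(* The constant 9 comes from [2 * interval_size m n D >= 3 * (m + 1) * (n + 1)],
   valid for m, n >= 1. *)
Lemma interior_bound m n D m' n' D' P Q X Y :
    diff_sizes m n D -> diff_sizes m' n' D' ->
    1 <= m -> 1 <= n -> 1 <= m' -> 1 <= n' ->
    P * Q = 9 * ((m + 1) * (n + 1) * ((m' + 1) * (n' + 1))) ->
    0 <= X <= P -> 0 <= 4 * Y <= Q ->
  X * Y <= interval_size m n D * interval_size m' n' D'.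
Proof.
case=> [m0 n0 D0 mnD] [m'0 n'0 D'0 mnD'] m1 n1 m'1 n'1 PQ XP YQ.
have half a b E : 1 <= a -> 1 <= b -> 1 <= E -> a + b - 1 <= E ->
    0 <= 3 * ((a + 1) * (b + 1)) <= 2 * interval_size a b E.
  by rewrite /interval_size; nia.
have h := half m n D m1 n1 D0 (proj1 mnD).
have h' := half m' n' D' m'1 n'1 D'0 (proj1 mnD').
(* The factor 4 is the product of the two factors 2 in [h] and [h']. *)
have : X * (4 * Y) <= P * Q by apply: Z.mul_le_mono_nonneg; lia.
have := Z.mul_le_mono_nonneg _ _ _ _ (proj1 h) (proj2 h) (proj1 h') (proj2 h').
lia.
Qed.

Ltac split_max := repeat match goal with |- context [Z.max ?a ?b] =>
  case: (Z.max_spec a b) => [[? ->]|[? ->]] end.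

(** [interior_bound] requires all four sizes to be positive; when one vanishes, the inequality is
    checked for each of the three values that [D] and [D'] can take. *)
Ltac boundary m n D m' n' D' :=
  (have [?|[?|?]] : D = m + n - 1 \/ D = m + n \/ D = m + n + 1 by lia);
  (have [?|[?|?]] : D' = m' + n' - 1 \/ D' = m' + n' \/ D' = m' + n' + 1
    by lia);
  rewrite /interval_size; subst; try lia; nia.

Ltac zero_or_pos m n D m' n' D' :=
  move=> [? ? ? ?] [? ? ? ?]; split_max; intros;
  (have [?|?] : m = 0 \/ 1 <= m; [lia | boundary m n D m' n' D' | ]);
  (have [?|?] : n = 0 \/ 1 <= n; [lia | boundary m n D m' n' D' | ]);
  (have [?|?] : m' = 0 \/ 1 <= m'; [lia | boundary m n D m' n' D' | ]);
  (have [?|?] : n' = 0 \/ 1 <= n'; [lia | boundary m n D m' n' D' | ]);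
  try (exfalso; lia).

Ltac interior p q :=
  apply: (@interior_bound _ _ _ _ _ _ p q);
  [by split; lia | by split; lia | lia | lia | lia | lia | ring | nia | nia].

(** In this and the next five lemmas, the axis tells whether [D] and [D'] belong to the same
    coordinate, and the sign whether the two differences have the same overall sign. A side is a
    maximum if its two entries have equal signs and a sum otherwise. The hypotheses make the side in
    the first factor the shortest; the suffix gives its position. *)
Lemma same_axis_same_sign m n D m' n' D' :
    diff_sizes m n D -> diff_sizes m' n' D' ->
    Z.max m m' <= Z.max n n' ->
  (Z.max m m' + 1) * (Z.max n n' + Z.max D D' + 1) <=
    interval_size m n D * interval_size m' n' D'.
Proof.
zero_or_pos m n D m' n' D';
by interior ((m + 1) * (m' + 1)) (9 * ((n + 1) * (n' + 1))).
Qed.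

Lemma same_axis_opp_sign m n D m' n' D' :
    diff_sizes m n D -> diff_sizes m' n' D' ->
    m + m' <= n + n' ->
  (m + m' + 1) * (n + n' + (D + D') + 1) <=
    interval_size m n D * interval_size m' n' D'.
Proof.
zero_or_pos m n D m' n' D';
by interior ((m + 1) * (m' + 1)) (9 * ((n + 1) * (n' + 1))).
Qed.

Lemma diff_axis_same_sign1 m n D m' n' D' :
    diff_sizes m n D -> diff_sizes m' n' D' ->
    Z.max m m' <= n + D' -> Z.max m m' <= D + n' ->
  (Z.max m m' + 1) * (n + D' + (D + n') + 1) <=
    interval_size m n D * interval_size m' n' D'.
Proof.
zero_or_pos m n D m' n' D'.
  by interior (m' + 1) (9 * ((m + 1) * ((n + 1) * (n' + 1)))).
by interior (m + 1) (9 * ((m' + 1) * ((n + 1) * (n' + 1)))).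
Qed.

Lemma diff_axis_same_sign2 m n D m' n' D' :
    diff_sizes m n D -> diff_sizes m' n' D' ->
    n + D' <= Z.max m m' -> n + D' <= D + n' ->
  (n + D' + 1) * (Z.max m m' + (D + n') + 1) <=
    interval_size m n D * interval_size m' n' D'.
Proof.
(* Here n + D' <= m, so the long factor is at most 3 * (m + 1); it takes the role of [X]. *)
zero_or_pos m n D m' n' D'; rewrite Z.mul_comm.
by interior (3 * (m + 1)) (3 * ((n + 1) * ((m' + 1) * (n' + 1)))).
Qed.

Lemma diff_axis_opp_sign1 m n D m' n' D' :
    diff_sizes m n D -> diff_sizes m' n' D' ->
    m + m' <= Z.max n D' -> m + m' <= Z.max D n' ->
  (m + m' + 1) * (Z.max n D' + Z.max D n' + 1) <=
    interval_size m n D * interval_size m' n' D'.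
Proof.
zero_or_pos m n D m' n' D';
by interior ((m + 1) * (m' + 1)) (9 * ((n + 1) * (n' + 1))).
Qed.

Lemma diff_axis_opp_sign2 m n D m' n' D' :
    diff_sizes m n D -> diff_sizes m' n' D' ->
    Z.max n D' <= m + m' -> Z.max n D' <= Z.max D n' ->
  (Z.max n D' + 1) * (m + m' + Z.max D n' + 1) <=
    interval_size m n D * interval_size m' n' D'.
Proof.
zero_or_pos m n D m' n' D'.
(* In the first two cases the shortest side is [D'], and D' + 1 <= m' + n' + 2 <= (m' + 1) * (n' +
   1); in the last it is [n]. *)
- by interior ((m' + 1) * (n' + 1)) (9 * ((m + 1) * (n + 1))).
- by interior ((m' + 1) * (n' + 1)) (9 * ((m + 1) * (n + 1))).
- by interior ((n + 1) * (n' + 1)) (9 * ((m + 1) * (m' + 1))).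
Qed.

Lemma hull_lenN x y : hull_len (- x) (- y) = hull_len x y.
Proof. by rewrite /hull_len; lia. Qed.

Lemma hull_len_same x y : 0 <= x -> 0 <= y -> hull_len x y = Z.max x y.
Proof. by rewrite /hull_len; lia. Qed.

Lemma hull_len_opp x y : 0 <= x -> 0 <= y -> hull_len x (- y) = x + y.
Proof. by rewrite /hull_len; lia. Qed.

Lemma slab_le_same_axis p1 p2 p3 r1 r2 r3 m n D m' n' D' :
    diff_sizes m n D -> diff_sizes m' n' D' ->
    signed_sizes p1 p2 p3 m n D -> signed_sizes r1 r2 r3 m' n' D' ->
  slab_le (hull_len p1 r1) (hull_len p2 r2) (hull_len p3 r3)
    (interval_size m n D * interval_size m' n' D').
Proof.
move=> K K'; have [[m0 _] [n0 _] D0 _] := K; have [[m'0 _] [n'0 _] D'0 _] := K'.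
have KC := diff_sizesC K; have K'C := diff_sizesC K'.
have same : slab_le (hull_len m m') (hull_len n n') (hull_len D D')
    (interval_size m n D * interval_size m' n' D').
  rewrite !hull_len_same; try lia; rewrite /slab_le.
  case: (Z.le_ge_cases (Z.max m m') (Z.max n n')) => h; [left|right; left].
    exact: same_axis_same_sign.
  by rewrite interval_sizeC (interval_sizeC m'); apply: same_axis_same_sign.
have opp : slab_le (hull_len m (- m')) (hull_len n (- n')) (hull_len D (- D'))
    (interval_size m n D * interval_size m' n' D').
  rewrite !hull_len_opp; try lia; rewrite /slab_le.
  case: (Z.le_ge_cases (m + m') (n + n')) => h; [left|right; left].
    exact: same_axis_opp_sign.
  by rewrite interval_sizeC (interval_sizeC m'); apply: same_axis_opp_sign.
case=> [[-> [-> ->]]|[-> [-> ->]]] [[-> [-> ->]]|[-> [-> ->]]] //.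
- by rewrite hull_lenN.
- by rewrite -(hull_lenN (- D)) !Z.opp_involutive.
- by rewrite -(hull_lenN (- m)) -(hull_lenN (- n)) !Z.opp_involutive.
- by rewrite !hull_lenN.
Qed.

(** Only the relative sign matters, by [hull_lenN]. Exchanging the two differences exchanges the
    second and third sides, which settles the case of a shortest third side. *)
Lemma slab_le_diff_axis p1 p2 p3 r1 r2 r3 m n D m' n' D' :
    diff_sizes m n D -> diff_sizes m' n' D' ->
    signed_sizes p1 p2 p3 m n D -> signed_sizes r1 r3 r2 m' n' D' ->
  slab_le (hull_len p1 r1) (hull_len p2 r2) (hull_len p3 r3)
    (interval_size m n D * interval_size m' n' D').
Proof.
move=> K K'; have [[m0 _] [n0 _] D0 _] := K; have [[m'0 _] [n'0 _] D'0 _] := K'.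
have same : slab_le (hull_len m m') (hull_len n (- D')) (hull_len D (- n'))
    (interval_size m n D * interval_size m' n' D').
  rewrite hull_len_same ?hull_len_opp; try lia; rewrite /slab_le.
  have := diff_axis_same_sign1 K K'; have := diff_axis_same_sign2 K K'.
  by have := diff_axis_same_sign2 K' K; rewrite (Z.max_comm m' m); lia.
have opp : slab_le (hull_len m (- m')) (hull_len n D') (hull_len D n')
    (interval_size m n D * interval_size m' n' D').
  rewrite hull_len_opp ?hull_len_same; try lia; rewrite /slab_le.
  have := diff_axis_opp_sign1 K K'; have := diff_axis_opp_sign2 K K'.
  have := diff_axis_opp_sign2 K' K; rewrite (Z.max_comm n' D) (Z.max_comm D' n).
  lia.
case=> [[-> [-> ->]]|[-> [-> ->]]] [[-> [-> ->]]|[-> [-> ->]]] //.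
- by rewrite -(hull_lenN (- D)) !Z.opp_involutive.
- by rewrite hull_lenN.
- by rewrite -(hull_lenN (- m)) -(hull_lenN (- n)) !Z.opp_involutive.
- by rewrite !hull_lenN -(hull_lenN (- n)) !Z.opp_involutive.
Qed.

Lemma slab_le_perm_sizes p1 p2 p3 r1 r2 r3 m n D m' n' D' :
    diff_sizes m n D -> diff_sizes m' n' D' ->
    perm_sizes p1 p2 p3 m n D -> perm_sizes r1 r2 r3 m' n' D' ->
  slab_le (hull_len p1 r1) (hull_len p2 r2) (hull_len p3 r3)
    (interval_size m n D * interval_size m' n' D').
Proof.
move=> K K'; have KC := diff_sizesC K; have K'C := diff_sizesC K'.
(* The nine cases are the positions of [D] and [D']. Equal positions give the same-axis lemma; the
   others reduce to [slab_le_diff_axis] by permuting coordinates and exchanging the two smaller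
   sizes where needed. *)
case=> [H|[H|H]] [H'|[H'|H']];
  have HC := signed_sizesC H; have HC' := signed_sizesC H'.
- exact: slab_le_same_axis.
- exact: slab_le_diff_axis.
- by apply: slab_leC; rewrite (interval_sizeC m); apply: slab_le_diff_axis.
- by apply/slab_leC/slab_le_rot/slab_le_rot; apply: slab_le_diff_axis.
- by apply/slab_leC/slab_le_rot/slab_le_rot; apply: slab_le_same_axis.
- apply: slab_le_rot; rewrite (interval_sizeC m) (interval_sizeC m').
  exact: slab_le_diff_axis.
- apply/slab_le_rot/slab_le_rot; rewrite (interval_sizeC m').
  exact: slab_le_diff_axis.
- apply/slab_le_rot/slab_le_rot/slab_leC.
  rewrite (interval_sizeC m) (interval_sizeC m').
  exact: slab_le_diff_axis.
- by apply/slab_le_rot/slab_le_rot; apply: slab_le_same_axis.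
Qed.

End Arithmetic.

(** * Cardinality bounds from injections *)

Section FiniteInjections.
Local Open Scope classical_set_scope.

Lemma card_inj_le (T : choiceType) (I : finType) (f : T -> I) (S : set T) :
    (forall x y, S x -> S y -> f x = f y -> x = y) ->
  finite_set S /\ (#|` fset_set S| <= #|I|)%N.
Proof.
move=> f_inj; have fin : finite_set S.
  have : {in S &, injective f}.
    by move=> x y /set_mem Sx /set_mem Sy; apply: f_inj.
  move=> /inj_card_eq; rewrite card_eq_le => /andP[_ /card_le_finite]; apply.
  exact: finite_finset.
split=> //; rewrite cardE -(size_map f); apply: uniq_leq_size => [|i _].
  rewrite map_inj_in_uniq ?fset_uniq // => x y.
  by rewrite !in_fset_set // => /set_mem Sx /set_mem Sy; apply: f_inj.
exact: mem_enum.
Qed.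

Lemma card_inj_ge (T : choiceType) (I : finType) (K : {set I}) (f : I -> T)
    (S : set T) :
    finite_set S -> {in K &, injective f} -> (forall i, i \in K -> S (f i)) ->
  (#|K| <= #|` fset_set S|)%N.
Proof.
move=> fin f_inj fS; rewrite cardE -(size_map f); apply: uniq_leq_size => [|x].
  by rewrite map_inj_in_uniq ?enum_uniq // => i j; rewrite !mem_enum; apply: f_inj.
case/mapP => i; rewrite mem_enum => iK ->.
by rewrite in_fset_set // mem_set //; apply: fS.
Qed.

End FiniteInjections.

(** * Counting lattice points *)

Section Counting.
Variable T : choiceType.
Local Open Scope Z_scope.
Notation card S := (Z.of_nat #|` fset_set S|).
Implicit Types (A B C : T -> Z) (S : set T).

Lemma card_box3_le A B C S u v w :
    hexcoord A B C -> (forall x, S x -> in_box3 A B C u v w x) ->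
  finite_set S /\
  card S <= (hull_len (A u - A v) (A w - A v) + 1) *
    (hull_len (B u - B v) (B w - B v) + hull_len (C u - C v) (C w - C v) + 1).
Proof.
case=> bd _ inj hS.
have len_ge0 x y : 0 <= hull_len x y by rewrite /hull_len; lia.
have hull F : F = A \/ F = B \/ F = C ->
  exists2 lo, 0 <= hull_len (F u - F v) (F w - F v)
    & forall x, S x -> lo <= F x <= lo + hull_len (F u - F v) (F w - F v).
  move=> hF; exists (Z.min (F u) (Z.min (F v) (F w))); first exact: len_ge0.
  by move=> x /hS /(_ F hF); rewrite /hull_len; lia.
have [|a0 + hA] := hull A; first by left.
have [|b0 + hB] := hull B; first by right; left.
have [|c0 + hC] := hull C; first by right; right.
move: (hull_len _ _) (hull_len _ _) (hull_len _ _) hA hB hC.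
move=> LC LB LA hA hB hC C0 B0 A0.
(* For fixed A, the sum B + C takes two consecutive values, told apart by the parity of B - C; hence
   B - C determines the point. The shift by [c0 + LC] makes the second entry range from 0 to
   [LB + LC]. *)
pose f x : 'I_(Z.to_nat LA).+1 * 'I_(Z.to_nat (LB + LC)).+1 :=
  (inord (Z.to_nat (A x - a0)), inord (Z.to_nat (B x - b0 - (C x - (c0 + LC))))).
have [|fin] := @card_inj_le T _ f S.
  move=> x y Sx Sy; have := hA x Sx; have := hB x Sx; have := hC x Sx.
  have := hA y Sy; have := hB y Sy; have := hC y Sy => ? ? ? ? ? ? [].
  move=> /(congr1 val) /=; rewrite !inordK; try by apply/ltP; lia.
  move=> eA /(congr1 val) /=; rewrite !inordK; try by apply/ltP; lia.
  move=> eBC; have := bd x; have := bd y => hx hy.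
  by apply: inj; lia.
rewrite card_prod !card_ord => /leP/inj_le h; split=> //; apply: Z.le_trans h _.
by rewrite -multE Nat2Z.inj_mul !Nat2Z.inj_succ !Z2Nat.id; lia.
Qed.

Lemma distC A B C x y : dist A B C x y = dist A B C y x.
Proof. by rewrite /dist; lia. Qed.

(* With [A u - A v = m], [B u - B v = n] and [C u - C v = - D], the interval
   consists of the points with (A, B) in a rectangle, two for each (A, B),
   except for at most one at each of the corners [v] and [u]. *)
Lemma card_interval_ge A B C S u v m n D :
    hexcoord A B C -> finite_set S ->
    (forall x, dist A B C u x + dist A B C x v = dist A B C u v -> S x) ->
    0 <= m -> 0 <= n -> 0 <= D ->
    signed_sizes (A u - A v) (B u - B v) (C u - C v) m n D ->
  interval_size m n D <= card S.
Proof.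
move=> hex fin hS m0 n0 D0.
wlog h : u v hS / A u - A v = m /\ B u - B v = n /\ C u - C v = - D.
  move=> W [h|h]; first by apply: (W u v) => //; left.
  apply: (W v u); last by left; lia.
    move=> x h'; apply: hS; move: h'.
    by rewrite !(distC A B C v) !(distC A B C _ u) Z.add_comm.
  by lia.
move=> _; case: hex => bd ex inj; case: h => hA [hB hC].
have hu := bd u; have hv := bd v.
have [Mm eM] : exists k, Z.of_nat k = m by exists (Z.to_nat m); lia.
have [Nn eN] : exists k, Z.of_nat k = n by exists (Z.to_nat n); lia.
pose I := ('I_Mm.+1 * 'I_Nn.+1 * bool)%type.
pose pa (i : I) := A v + Z.of_nat i.1.1.
pose pb (i : I) := B v + Z.of_nat i.1.2.
pose pc (i : I) := (if i.2 then 1 else 0) - pa i - pb i.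
have /choice[f fP] : forall i, exists x, [/\ A x = pa i, B x = pb i & C x = pc i].
  by move=> i; apply: ex; rewrite /pc; case: i.2; lia.
(* The boolean is the coordinate sum. Over the corner [v], the point of sum 1 has C = C v + 1 if [v]
   has sum 0; over the corner [u], the point of sum 0 has C = C u - 1 if [u] has sum 1. Both then
   lie outside the interval. *)
pose bad0 : I := (ord0, ord0, true); pose bad1 : I := (ord_max, ord_max, false).
pose X0 := if A v + B v + C v =? 0 then [set bad0] else finset.set0.
pose X1 := if A u + B u + C u =? 1 then [set bad1] else finset.set0.
pose K := finset.setC (finset.setU X0 X1).
have c0 : Z.of_nat #|X0| = 1 - (A v + B v + C v).
  by rewrite /X0; case: Z.eqb_spec => h; rewrite ?cards1 ?cards0; lia.
have c1' : Z.of_nat #|X1| = A u + B u + C u.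
  by rewrite /X1; case: Z.eqb_spec => h; rewrite ?cards1 ?cards0; lia.
(* Of the 2 * (m + 1) * (n + 1) candidates, at most 1 + m + n - D are removed. *)
have cK : interval_size m n D <= Z.of_nat #|K|.
  have /(congr1 Z.of_nat) := cardsC (finset.setU X0 X1).
  rewrite -/K !card_prod card_bool !card_ord -multE -plusE.
  rewrite Nat2Z.inj_add !Nat2Z.inj_mul !Nat2Z.inj_succ eM eN => h.
  have /leP/inj_le := leq_card_setU X0 X1; rewrite -plusE Nat2Z.inj_add /interval_size.
  by move: h; rewrite c0 c1'; lia.
apply: (Z.le_trans _ _ _ cK); apply/inj_le/leP; apply: (card_inj_ge (f := f)) => //.
  move=> i j _ _ fij; have [ai bi ci] := fP i; have [aj bj cj] := fP j.
  rewrite fij aj in ai; rewrite fij bj in bi; rewrite fij cj in ci.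
  case: i j {fij aj bj cj} ai bi ci => [[i1 i2] i3] [[j1 j2] j3].
  rewrite /pc /pa /pb /= => ai bi ci.
  congr (_, _, _); [apply: val_inj => /=; lia..|].
  by case: i3 j3 ci => -[] //; lia.
move=> i iK; apply: hS; have := fP i; move: (f i) => x; case: i iK => -[i1 i2] i3 iK.
have /ltP h1 := ltn_ord i1; have /ltP h2 := ltn_ord i2.
rewrite /pc /pa /pb /= => -[ai bi ci].
(* A and B lie in the rectangle by construction, so only C can leave the interval, and it does so
   only at the removed corners. *)
suff hc : C u <= C x <= C v.
  have ha : A v <= A x <= A u by rewrite ai; lia.
  have hb : B v <= B x <= B u by rewrite bi; lia.
  by rewrite /dist; lia.
move: iK; rewrite !inE negb_or ci => /andP[nb0 nb1].
case: i3 {ai bi ci} nb0 nb1 => /= nb0 nb1.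
  split; first lia.
  suff : A v + B v + C v <> 0 \/ Z.of_nat i1 <> 0 \/ Z.of_nat i2 <> 0 by lia.
  apply: contrapT => h; move: nb0; rewrite /X0.
  have -> : A v + B v + C v =? 0 by apply/Z.eqb_spec; lia.
  rewrite inE => /eqP; apply; rewrite /bad0.
  by congr (_, _, _); apply: val_inj => /=; lia.
split; last lia.
suff : A u + B u + C u <> 1 \/ Z.of_nat i1 <> m \/ Z.of_nat i2 <> n by lia.
apply: contrapT => h; move: nb1; rewrite /X1.
have -> : A u + B u + C u =? 1 by apply/Z.eqb_spec; lia.
rewrite inE => /eqP; apply; rewrite /bad1.
by congr (_, _, _); apply: val_inj => /=; lia.
Qed.

Lemma hexcoord_rot A B C : hexcoord A B C -> hexcoord B C A.
Proof.
case=> bd ex inj; split=> [x|a b c abc|x y eB eC eA]; first by have := bd x; lia.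
  by have [|x [eA eB eC]] := ex c a b; [lia | exists x].
exact: inj.
Qed.

Lemma hexcoord_swap A B C : hexcoord A B C -> hexcoord B A C.
Proof.
case=> bd ex inj; split=> [x|a b c abc|x y eB eA eC]; first by have := bd x; lia.
  by have [|x [eA eB eC]] := ex b a c; [lia | exists x].
exact: inj.
Qed.

Lemma card_interval_perm_ge A B C S u v m n D :
    hexcoord A B C -> finite_set S ->
    (forall x, dist A B C u x + dist A B C x v = dist A B C u v -> S x) ->
    diff_sizes m n D -> perm_sizes (A u - A v) (B u - B v) (C u - C v) m n D ->
  interval_size m n D <= card S.
Proof.
move=> hex fin hS [[m0 _] [n0 _] D1 _] F; have D0 : 0 <= D by lia.
have dAC x y : dist A C B x y = dist A B C x y by rewrite /dist; ring.
have dBC x y : dist B C A x y = dist A B C x y by rewrite /dist; ring.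
have hexBC := hexcoord_rot hex.
have hexAC := hexcoord_swap (hexcoord_rot hexBC).
case: F => [F|[F|F]].
- exact: (card_interval_ge hex fin hS).
- by apply: (card_interval_ge hexAC fin _ _ _ _ F) => // x; rewrite !dAC; apply: hS.
- by apply: (card_interval_ge hexBC fin _ _ _ _ F) => // x; rewrite !dBC; apply: hS.
Qed.

Lemma box3_le_interval_mul A B C (S1 S2 S3 : set T) u v w :
    hexcoord A B C -> u <> v -> v <> w -> finite_set S1 -> finite_set S2 ->
    (forall x, dist A B C u x + dist A B C x v = dist A B C u v -> S1 x) ->
    (forall x, dist A B C v x + dist A B C x w = dist A B C v w -> S2 x) ->
    (forall x, S3 x -> in_box3 A B C u v w x) ->
  card S3 <= card S1 * card S2.
Proof.
move=> hex nuv nvw fin1 fin2 h1 h2 h3; case: (hex) => bd _ inj.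
have nz x y : x <> y -> A x - A y <> 0 \/ B x - B y <> 0 \/ C x - C y <> 0.
  by move=> nxy; apply: contrapT => h; apply: nxy; apply: inj; lia.
have bdu := bd u; have bdv := bd v; have bdw := bd w.
have [||m [n [D [K F]]]] :=
    @perm_sizes_exist (A u - A v) (B u - B v) (C u - C v).
- by lia.
- exact: nz.
(* The difference is w - v, not v - w: both differences are based at the shared point v, as in
   [hull_len]. *)
have [||m' [n' [D' [K' F']]]] :=
    @perm_sizes_exist (A w - A v) (B w - B v) (C w - C v).
- by lia.
- by apply: nz => e; apply: nvw.
have N1 := card_interval_perm_ge hex fin1 h1 K F.
have N2 : interval_size m' n' D' <= card S2.
  apply: (card_interval_perm_ge hex fin2 _ K' F') => x.
  by rewrite !(distC A B C w) (distC A B C x v) Z.add_comm; apply: h2.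
have NN : interval_size m n D * interval_size m' n' D' <= card S1 * card S2.
  apply: Z.mul_le_mono_nonneg => //.
    by case: K => *; rewrite /interval_size; nia.
  by case: K' => *; rewrite /interval_size; nia.
apply: Z.le_trans NN.
have hexB := hexcoord_swap hex; have hexC := hexcoord_rot (hexcoord_rot hex).
case: (slab_le_perm_sizes K K' F F') => [|[|]]; apply: Z.le_trans.
- exact: (card_box3_le hex h3).2.
- by apply: (card_box3_le hexB _).2 => x /h3 h G hG; apply: h; tauto.
- by apply: (card_box3_le hexC _).2 => x /h3 h G hG; apply: h; tauto.
Qed.

End Counting.

Theorem theorem3p2 (W : groupType) (s : 'I_3 -> W) (hW : A2tilde_group s) :
  strong_hull_property (cayley (range s)).
Proof.
have [A [B [C [hex eE]]]] := A2tilde_coords hW.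
move=> u v w; set e := cayley _.
have fin3 x y z : finite_set (Conv e [set x; y; z]%classic).
  by have [] := card_box3_le hex (@Conv_box3 _ _ _ _ _ hex eE x y z).
have fin2 x y : finite_set (Conv e [set x; y]%classic).
  by have := fin3 x x y; rewrite setUid.
have pos x y : (0 < #|` fset_set (Conv e [set x; y]%classic)|)%N.
  rewrite cardfs_gt0; apply/fset0Pn; exists x; rewrite in_fset_set //.
  by apply/mem_set; apply: sub_gen_smallest; left.
split; first exact: fin3.
(* If v equals u or w, the triple hull is one of the factors and the other is at least 1. Otherwise
   both differences are nonzero, so that D, D' >= 1. *)
have [->|nuv] := EM (u = v).
  by have := pos v v; rewrite setUid; apply: leq_pmull.
have [->|nvw] := EM (v = w).
  by have := pos w w; rewrite -setUA setUid; apply: leq_pmulr.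
have h := box3_le_interval_mul hex nuv nvw (fin2 u v) (fin2 v w)
  (@Conv_between _ _ _ _ _ hex eE u v) (@Conv_between _ _ _ _ _ hex eE v w)
  (@Conv_box3 _ _ _ _ _ hex eE u v w).
by apply/leP/Nat2Z.inj_le; rewrite -multE Nat2Z.inj_mul.
Qed.
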